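(* Let $n\ge 1$ and $1\le k\le \lceil n/2\rceil$ be integers. The number of partitions $\pi$ into exactly $k$ parts, all distinct, with $\Gamma(\pi)=n$ equals the number of partitions $\lambda$ into odd parts with largest part $\lambda_1=2k-1$ and $\Gamma(\lambda)=n$. Both numbers equal $\binom{n-k}{k-1}$.
   Context: For a non-empty partition $\pi=(\pi_1\ge\cdots\ge\pi_r\ge1)$, $\ell(\pi)=r$ and $\Gamma(\pi)=\pi_1+\ell(\pi)-1$ (length of the largest hook). *)

(* Defs.v *)
From mathcomp Require Import all_boot.
Set Implicit Arguments.
Unset Strict Implicit.
Unset Printing Implicit Defensive.

Local Open Scope nat_scope.

(* Partitions are sequences of parts in weakly decreasing order; the empty
   partition is excluded, since [Gamma] is only meaningful for non-empty ones. *)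
Definition is_partition (p : seq nat) : bool :=
  [&& p != [::], sorted geq p & all (fun i => 1 <= i) p].

(* The first part of a weakly decreasing sequence is its largest one; the
   default value 0 is only returned on the empty sequence. *)
Definition largest_part (p : seq nat) : nat := head 0 p.

Definition Gamma (p : seq nat) : nat := largest_part p + size p - 1.

(* Main.v *)
(** A partition [h :: q] with prescribed largest part [h] is determined by its
    tail [q]. Reading [q] backwards and relabelling the admissible parts as
    [0, ..., N - 1] turns tails with distinct parts into strictly increasing
    sequences of length [k - 1] below [n - k], and tails with odd parts into
    weakly increasing sequences of length [n + 1 - 2k] below [k]. Stars and bars
    gives [C(n - k, k - 1)] in both cases. *)
Require Import Defs.
From mathcomp Require Import all_boot.
From mathcomp Require Import zify.
From mathcomp Require Import classical_sets functions cardinality.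

Local Open Scope nat_scope.
Local Open Scope classical_set_scope.
Local Open Scope card_scope.

(** Bridges [#|B|] on finite types and [#=] on sets. Injectivity of [f] reduces the claim to [B]
    itself, whose elements are numbered by their position in [enum B]. *)
Lemma card_eq_finset_image (T : finType) (U : Type) (B : {set T}) (f : T -> U) :
  injective f -> [set f x | x in [set` B]] #= `I_#|B|.
Proof.
move=> finj; apply: card_eq_trans; first by apply: inj_card_eq => x y _ _ /finj.
have <- : [set index x (enum B) | x in [set` B]] = `I_#|B|.
  apply/seteqP; split=> [_ [x /= xB <-]|i /= iB].
    by rewrite /= cardE index_mem mem_enum.
  case: (set_0Vmem B) iB => [->|[x0 _]]; first by rewrite cards0.
  rewrite cardE => iB; exists (nth x0 (enum B) i).
    by rewrite /= -mem_enum mem_nth.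
  by rewrite index_uniq // enum_uniq.
rewrite card_eq_sym; apply: inj_card_eq => x y; rewrite !inE => xB yB.
by move=> /index_inj -> //; rewrite mem_enum.
Qed.

Lemma lift_seq_ord (N : nat) (s : seq nat) :
  all (fun i => i < N) s -> exists t : seq 'I_N, map val t = s.
Proof.
elim: s => [|i s IHs] /= => [_|/andP[iN /IHs[t <-]]]; first by exists [::].
by exists (Ordinal iN :: t).
Qed.

(* The parts allowed in the tail are the values [g i] with [i < N]. *)
Definition tail_coded (e : rel nat) (g g' : nat -> nat) (m N : nat)
    (q : seq nat) : bool :=
  [&& size q == m, sorted (fun x y => e y x) q
    & all (fun x => (g (g' x) == x) && (g' x < N)) q].

(** Sending a sorted tuple [t] to [h :: rev (map (g \o val) t)] is a bijection: [g] preserves and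
    reflects [e], and [rev] turns increasing codes into decreasing parts. *)
Lemma card_tail_coded (e : rel nat) (g g' : nat -> nat) (h m N : nat) :
  cancel g g' -> {mono g : x y / e x y} ->
  [set h :: q | q in [set q | tail_coded e g g' m N q]] #=
    `I_#|[set t : m.-tuple 'I_N | sorted e (map val t)]%SET|.
Proof.
move=> gK g_mono; pose f (t : m.-tuple 'I_N) := h :: rev (map (g \o val) t).
have f_inj : injective f.
  move=> t1 t2 /(congr1 (rev \o behead)); rewrite /f /= !revK.
  by move=> /(inj_map (inj_comp (can_inj gK) val_inj)) /val_inj.
apply: card_eq_trans (card_eq_finset_image _ _ _ _ f_inj).
suff -> : [set h :: q | q in [set q | tail_coded e g g' m N q]] =
    [set f t | t in [set` [set t : m.-tuple 'I_N | sorted e (map val t)]%SET]].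
  exact: card_eqxx.
apply/seteqP; split=> [_ [q /= /and3P[/eqP szq srt qN] <-]|_ [t /= tB <-]].
  (* The preimage of [h :: q] is [rev q] decoded entrywise by [g']. *)
  have [|t tq] := lift_seq_ord N (map g' (rev q)).
    rewrite all_map all_rev; apply: sub_all qN => x /= /andP[] //.
  have qE : map g (map g' (rev q)) = rev q.
    rewrite -map_comp -[RHS]map_id; apply/eq_in_map => x.
    by rewrite mem_rev => /(allP qN) /andP[/eqP].
  have szt : size t == m by rewrite -(size_map val) tq size_map size_rev szq.
  exists (Tuple szt); last by rewrite /f /= map_comp tq qE revK.
  by rewrite /= inE /= tq -(mono_sorted g_mono) qE rev_sorted.
exists (rev (map (g \o val) t)) => //; apply/and3P; split.
- by rewrite size_rev size_map size_tuple.
- rewrite rev_sorted map_comp (mono_sorted g_mono).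
  by move: tB; rewrite inE.
- by rewrite all_rev all_map; apply/allP => i _ /=; rewrite gK eqxx /=.
Qed.

(** With [k] parts, [Gamma p = n] forces the largest part to be [n - k + 1]; the other [k - 1] parts
    are then distinct numbers from 1 to [n - k]. *)
Lemma distinct_partsE (n k : nat) : 1 <= k <= n ->
  [set p : seq nat | [/\ is_partition p, size p = k, uniq p & Gamma p = n]] =
  [set (n - k).+1 :: q | q in
    [set q | tail_coded ltn succn predn (k - 1) (n - k) q]].
Proof.
move=> /andP[k_gt0 le_kn]; apply/seteqP; split=> [|_ [q /= qP <-]].
  case=> [|x q] [] /and3P[//= _ srt /andP[x_gt0 q_gt0]] szq uq.
  rewrite /Gamma /= => xn.
  have xE : x = (n - k).+1 by lia.
  (* Weakly decreasing without repetition means strictly decreasing, so the tail stays strictly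
     below [x]. *)
  have {}srt : sorted gtn (x :: q) by rewrite gtn_sorted_uniq_geq /= uq.
  exists q; last by rewrite xE.
  rewrite /= /tail_coded (path_sorted srt).
  apply/and3P; split => //; first by apply/eqP; lia.
  have /allP q_lt := order_path_min (rev_trans ltn_trans) srt.
  by apply/allP => y yq; have := q_lt _ yq; have /= := allP q_gt0 _ yq; lia.
case/and3P: qP => /eqP szq srt qN.
have srt1 : sorted gtn ((n - k).+1 :: q).
  rewrite /= path_min_sorted //.
  by apply/allP => y /(allP qN) /= /andP[/eqP <-]; rewrite ltnS.
move: (srt1); rewrite gtn_sorted_uniq_geq => /andP[uq srt2].
split => //; last by rewrite /Gamma /= szq; lia.
- apply/and3P; split => //=.
  by apply/allP => y /(allP qN) /= /andP[/eqP <-].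
- by rewrite /= szq; lia.
Qed.

(** With largest part [2 * k - 1], [Gamma p = n] forces [n + 2 - 2 * k] parts, one of them the head;
    odd numbers up to [2 * k - 1] are the [2 * i + 1] with [i < k]. *)
Lemma odd_partsE (n k : nat) : 1 <= k -> 2 * k - 1 <= n ->
  [set p : seq nat |
    [/\ is_partition p, all odd p, largest_part p = 2 * k - 1 & Gamma p = n]] =
  [set 2 * k - 1 :: q | q in
    [set q | tail_coded leq (fun i => i.*2.+1) half (n.+1 - 2 * k) k q]].
Proof.
move=> k_gt0 le_kn; apply/seteqP; split=> [|_ [q /= qP <-]].
  case=> [|x q] [] /and3P[//= _ srt _] /andP[_ q_odd].
  rewrite /Gamma /= => xE xn; exists q; last by rewrite xE.
  rewrite /= /tail_coded (path_sorted srt).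
  apply/and3P; split => //; first by apply/eqP; lia.
  have /allP q_le := order_path_min (rev_trans leq_trans) srt.
  apply/allP => y yq; have y_odd : odd y := allP q_odd _ yq.
  have le_yx : y <= x := q_le _ yq.
  by rewrite -[X in _ == X]odd_double_half y_odd add1n eqxx /=; lia.
case/and3P: qP => /eqP szq srt qN.
split => //; last by rewrite /Gamma /= szq; lia.
- apply/and3P; split => //=.
    by rewrite path_min_sorted //; apply/allP => y /(allP qN) /=; lia.
  by apply/andP; split; [lia|]; apply/allP => y /(allP qN) /=; lia.
- by rewrite /=; apply/andP; split; [lia|]; apply/allP => y /(allP qN) /=; lia.
Qed.

Theorem theorem2p7 (n k : nat) (hn : 1 <= n) (hk1 : 1 <= k)
    (hk2 : k <= uphalf n) :
  let distinct_parts := [set p : seq nat |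
    [/\ is_partition p, size p = k, uniq p & Gamma p = n]] in
  let odd_parts := [set p : seq nat |
    [/\ is_partition p, all odd p, largest_part p = 2 * k - 1 & Gamma p = n]] in
  [/\ distinct_parts #= odd_parts,
      distinct_parts #= `I_('C(n - k, k - 1)) &
      odd_parts #= `I_('C(n - k, k - 1))].
Proof.
have le_kn : k <= n by lia.
(* [uphalf n] is the ceiling of [n / 2]. *)
have le_2kn : 2 * k - 1 <= n by lia.
move=> distinct_parts odd_parts.
have distinctI : distinct_parts #= `I_('C(n - k, k - 1)).
  rewrite /distinct_parts distinct_partsE ?hk1 // -card_ltn_sorted_tuples.
  exact: card_tail_coded.
have oddI : odd_parts #= `I_('C(n - k, k - 1)).
  rewrite /odd_parts odd_partsE //.
  have -> : 'C(n - k, k - 1) =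
      #|[set t : (n.+1 - 2 * k).-tuple 'I_k | sorted leq (map val t)]%SET|.
    (* The count of weakly increasing tuples is stated over ['I_j.+1], hence [k = j.+1]; symmetry of
       binomial coefficients then matches the lower indices [k - 1] and [n + 1 - 2 * k]. *)
    case: k hk1 le_kn le_2kn {hk2 distinct_parts odd_parts distinctI} => // j _ le_jn le_2jn.
    rewrite card_sorted_tuples -bin_sub; last by lia.
    by congr 'C(_, _); lia.
  apply: card_tail_coded => [i|i j]; first by lia.
  by rewrite ltnS leq_double.
split=> //; apply: card_eq_trans distinctI _.
by rewrite card_eq_sym.
Qed.
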